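(* Let $A$ be a straight algebra of dimension $2$ over $\mathbb F_2$. Then: (i) $A$ is unital if and only if it is isomorphic to one of $S_7$ and $S_{11}$. (ii) $A$ is commutative if and only if it is isomorphic to one of $S_i$ $(5\le i\le 11)$ and $S'_i$ $(1\le i\le 9)$. (iii) $A$ is associative if and only if it is isomorphic to one of $S_7, S_8, S_{10}$ and $S'_{10}$.
   Context: An algebra over the two-element field $\mathbb F_2$ is an $\mathbb F_2$-vector space with a bilinear multiplication, not assumed associative, commutative or unital; unital means having a two-sided identity element. A two-dimensional algebra is curled if, for every element $x$, the square $x^2$ is a scalar multiple of $x$; it is straight if it is not curled. For $p,q,a,b,c,d\in\mathbb F_2$, $S(p,q,a,b,c,d)$ denotes the two-dimensional algebra over $\mathbb F_2$ with linear base $\{e,f\}$ and $e^2=f$, $f^2=pe+qf$, $ef=ae+bf$, $fe=ce+df$. Put $S_5=S(1,1,1,0,1,0)$, $S_6=S(1,0,0,0,0,0)$, $S_7=S(1,0,1,1,1,1)$, $S_8=S(0,0,0,0,0,0)$, $S_9=S(0,0,0,1,0,1)$, $S_{10}=S(0,1,0,1,0,1)$, $S_{11}=S(0,1,1,0,1,0)$, and $S'_1=S(0,0,1,0,1,0)$, $S'_2=S(0,0,1,1,1,1)$, $S'_3=S(0,1,0,0,0,0)$, $S'_4=S(0,1,1,1,1,1)$, $S'_5=S(1,0,0,1,0,1)$, $S'_6=S(1,0,1,0,1,0)$, $S'_7=S(1,1,0,0,0,0)$, $S'_8=S(1,1,0,1,0,1)$, $S'_9=S(1,1,1,1,1,1)$,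 $S'_{10}=S(0,1,1,0,1,0)$. *)

(* Defs.v *)
From HB Require Import structures.
From mathcomp Require Import all_boot all_order all_algebra sesquilinear.
From mathcomp Require Import ring.
Set Implicit Arguments.
Unset Strict Implicit.
Unset Printing Implicit Defensive.
Import GRing.Theory.
Local Open Scope ring_scope.

(* An algebra over F_2 is an 'F_2-module A together with a multiplication     *)
(* m : {bilinear A -> A -> A}; nothing else is assumed about m.               *)

Section AlgebraProperties.
Variables (A : lmodType 'F_2) (m : {bilinear A -> A -> A}).

Definition curled : Prop := forall x : A, exists k : 'F_2, m x x = k *: x.

Definition straight : Prop := ~ curled.

Definition unital : Prop := exists u : A, left_id u m /\ right_id u m.

End AlgebraProperties.

Definition isomorphic (A B : lmodType 'F_2)
    (m : {bilinear A -> A -> A}) (n : {bilinear B -> B -> B}) : Prop :=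
  exists2 h : {linear A -> B},
    bijective h & forall x y : A, h (m x y) = n (h x) (h y).

Definition base_e : 'rV['F_2]_2 := delta_mx 0 0.
Definition base_f : 'rV['F_2]_2 := delta_mx 0 1.

(* Bilinear extension of e^2 = f, f^2 = pe + qf, ef = ae + bf, fe = ce + df   *)
(* to x = (x 0 0) e + (x 0 1) f and y = (y 0 0) e + (y 0 1) f.                *)
Definition alg_mul (p q a b c d : 'F_2) (x y : 'rV['F_2]_2) : 'rV['F_2]_2 :=
  (x 0 0 * y 0 0) *: base_f
  + (x 0 1 * y 0 1) *: (p *: base_e + q *: base_f)
  + (x 0 0 * y 0 1) *: (a *: base_e + b *: base_f)
  + (x 0 1 * y 0 0) *: (c *: base_e + d *: base_f).

Lemma alg_mul_is_bilinear p q a b c d :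
  bilinear_for (GRing.Scale.Law.clone _ _ *:%R _)
    (GRing.Scale.Law.clone _ _ *:%R _) (alg_mul p q a b c d).
Proof.
by split=> [z|z] k x y; apply/rowP=> i; rewrite /alg_mul !mxE; ring.
Qed.

HB.instance Definition _ p q a b c d :=
  bilinear_isBilinear.Build 'F_2 'rV['F_2]_2 'rV['F_2]_2 'rV['F_2]_2 _ _
    (alg_mul p q a b c d) (alg_mul_is_bilinear p q a b c d).

Definition algS (p q a b c d : 'F_2) :
    {bilinear 'rV['F_2]_2 -> 'rV['F_2]_2 -> 'rV['F_2]_2} :=
  alg_mul p q a b c d.

Lemma algS_table (p q a b c d : 'F_2) (S := algS p q a b c d) :
  [/\ S base_e base_e = base_f,
      S base_f base_f = p *: base_e + q *: base_f,
      S base_e base_f = a *: base_e + b *: base_f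
    & S base_f base_e = c *: base_e + d *: base_f].
Proof.
by split; rewrite /S /= /alg_mul !mxE /= ?(mulr1, mulr0, mul0r, scale1r, scale0r,
  addr0, add0r).
Qed.

Definition S5 := algS 1 1 1 0 1 0.
Definition S6 := algS 1 0 0 0 0 0.
Definition S7 := algS 1 0 1 1 1 1.
Definition S8 := algS 0 0 0 0 0 0.
Definition S9 := algS 0 0 0 1 0 1.
Definition S10 := algS 0 1 0 1 0 1.
Definition S11 := algS 0 1 1 0 1 0.

Definition S'1 := algS 0 0 1 0 1 0.
Definition S'2 := algS 0 0 1 1 1 1.
Definition S'3 := algS 0 1 0 0 0 0.
Definition S'4 := algS 0 1 1 1 1 1.
Definition S'5 := algS 1 0 0 1 0 1.
Definition S'6 := algS 1 0 1 0 1 0.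
Definition S'7 := algS 1 1 0 0 0 0.
Definition S'8 := algS 1 1 0 1 0 1.
Definition S'9 := algS 1 1 1 1 1 1.
(* Same parameters as S11; the list repeats this algebra under a second name. *)
Definition S'10 := algS 0 1 1 0 1 0.

(* Main.v *)
From HB Require Import structures.
Require Import Defs.
From mathcomp Require Import all_boot all_order all_algebra sesquilinear.
From mathcomp Require Import ring finfield.
Set Implicit Arguments.
Unset Strict Implicit.
Unset Printing Implicit Defensive.
Import GRing.Theory.
Local Open Scope ring_scope.

(** A straight algebra contains an element e whose square f := e^2 is not a
    multiple of e. In dimension 2 the pair (e, f) is then a basis, and reading
    the products f^2, ef, fe off in this basis shows that the algebra is
    isomorphic to S(p,q,a,b,c,d) for some parameters ([straight_isomorphic]).

    Since the three properties are invariant under isomorphism, it remains to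
    decide them for S(p,q,a,b,c,d), where each becomes a system of equations
    in the parameters:
    - S is commutative iff ef = fe, that is c = a and d = b; all sixteen
      choices of (p,q,a,b) occur in the list of (ii);
    - an identity element must be u = de + f, and this is one iff p = b = d,
      q = 1 - d and a = c = 1; the cases d = 1 and d = 0 are S_7 and S_11;
    - associativity gives ef = e^3 = fe, and e^4 computed as f^2 and as e(ef)
      gives p = ab and q = a + b^2. Conversely these equations present S as the
      ideal generated by X in F_2[X]/(X^3 - bX^2 - aX), with e = X. The four
      choices of (a,b) yield S_8, S_10, S_11 = S'_10 and S_7. *)

(** * Scalars and coordinates *)

Lemma F2_0or1 (x : 'F_2) : x = 0 \/ x = 1.
Proof.
by case: x => [[|[|//]] lt_x2]; [left | right]; apply: val_inj.
Qed.

Lemma F2_mulrr (x : 'F_2) : x * x = x.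
Proof. by case: (F2_0or1 x) => ->; rewrite ?mulr0 ?mulr1. Qed.

Lemma F2_addrr (x : 'F_2) : x + x = 0.
Proof. by case: (F2_0or1 x) => ->; apply/eqP. Qed.

Lemma F2_addr_eq0 (x y : 'F_2) : x + y = 0 -> x = y.
Proof.
by case: (F2_0or1 x) (F2_0or1 y) => -> [] -> //; rewrite ?add0r ?addr0.
Qed.

Section Coordinates.
Variables (p q a b c d : 'F_2).
Local Notation S := (algS p q a b c d).

Lemma algS_coord_e x y :
  S x y 0 0 = x 0 1 * y 0 1 * p + x 0 0 * y 0 1 * a + x 0 1 * y 0 0 * c.
Proof. by rewrite /= /alg_mul !mxE /=; ring. Qed.

Lemma algS_coord_f x y :
  S x y 0 1 = x 0 0 * y 0 0 + x 0 1 * y 0 1 * q + x 0 0 * y 0 1 * b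
              + x 0 1 * y 0 0 * d.
Proof. by rewrite /= /alg_mul !mxE /=; ring. Qed.

End Coordinates.

Lemma row2P (x y : 'rV['F_2]_2) : x 0 0 = y 0 0 -> x 0 1 = y 0 1 -> x = y.
Proof.
move=> eq_e eq_f; apply/rowP=> -[[|[|//]] lt_i2].
- by rewrite (_ : Ordinal lt_i2 = 0) //; apply: val_inj.
- by rewrite (_ : Ordinal lt_i2 = 1) //; apply: val_inj.
Qed.

Lemma row2_decomp (x : 'rV['F_2]_2) : x = x 0 0 *: base_e + x 0 1 *: base_f.
Proof.
by apply: row2P; rewrite !mxE /= ?(mulr1, mulr0) ?addr0 ?add0r.
Qed.

(** * Normal form of a straight algebra *)

Section NormalForm.
Variables (A : vectType 'F_2) (m : {bilinear A -> A -> A}).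
Hypothesis dimA : \dim {:A} = 2%N.

(** A is finite, so the witness can be extracted from a failing universal
    statement by exhaustive search. *)
Lemma straight_witness :
  straight m -> exists e : A, m e e \notin <[e]>%VS.
Proof.
move=> straight_m.
case: (boolP [exists x : finvect_type A, m x x \notin <[x : A]>%VS]).
  by case/existsP=> x not_line; exists x.
move=> /existsPn no_witness; case: straight_m => x.
by have := no_witness x; rewrite negbK => /vlineP.
Qed.

Lemma free_square (e : A) : m e e \notin <[e]>%VS -> free [:: e; m e e].
Proof.
move=> not_line; rewrite (perm_free (_ : perm_eq _ [:: m e e; e])).
  rewrite free_cons span_seq1 not_line seq1_free.
  by apply: contraNneq not_line => ->; rewrite linear0l mem0v.
by rewrite (perm_catC [:: e] [:: m e e]).
Qed.

(** The isomorphism is the coordinate map in the basis (e, e^2); it is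
    multiplicative because both products are bilinear and agree on the basis. *)
Lemma straight_isomorphic : straight m ->
  exists p q a b c d : 'F_2, isomorphic m (algS p q a b c d).
Proof.
move=> /straight_witness[e not_line].
set f := m e e; pose X := [tuple e; f].
have freeX : free X := free_square not_line.
have basisX : basis_of fullv X.
  by rewrite basisEfree freeX subvf dimA size_tuple.
have [h hE] : exists h : {linear A -> 'rV['F_2]_2},
    forall x i, h x 0 i = coord X i x.
  pose h0 x : 'rV['F_2]_2 := \row_i coord X i x.
  have h0_lin : linear h0.
    by move=> k x y; apply/rowP=> i; rewrite !mxE linearP.
  pose h : {linear A -> 'rV['F_2]_2} :=
    HB.pack h0 (GRing.isLinear.Build _ _ _ _ h0 h0_lin).
  by exists h => x i; rewrite mxE.
have he : h e = base_e.
  by apply/rowP=> i; rewrite hE mxE (coord_free (0 : 'I_2) i freeX) eq_sym.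
have hf : h f = base_f.
  by apply/rowP=> i; rewrite hE mxE (coord_free (1 : 'I_2) i freeX) eq_sym.
have coordK x : x = h x 0 0 *: e + h x 0 1 *: f.
  rewrite {1}(coord_basis basisX (memvf x)) big_ord_recl big_ord1 /= !hE.
  by congr (_ + coord X _ x *: _); apply: val_inj.
exists (h (m f f) 0 0), (h (m f f) 0 1), (h (m e f) 0 0), (h (m e f) 0 1),
  (h (m f e) 0 0), (h (m f e) 0 1).
exists h => [|x y].
  exists (fun v : 'rV_2 => v 0 0 *: e + v 0 1 *: f) => [x | v]; first by rewrite -coordK.
  by rewrite linearD !linearZ he hf -row2_decomp.
rewrite {1}(coordK x) {1}(coordK y).
rewrite !(linearDl, linearDr, linearZl_LR, linearZr_LR) /=.
rewrite -/f !linearD !linearZ hf /alg_mul -!row2_decomp /=.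
by rewrite !scalerA -!addrA; congr (_ + _); rewrite [RHS]addrC -addrA.
Qed.

End NormalForm.

(** * Invariance under isomorphism *)

Section Invariance.
Variables (A B : lmodType 'F_2).
Variables (m : {bilinear A -> A -> A}) (n : {bilinear B -> B -> B}).
Hypothesis iso_mn : isomorphic m n.

Lemma isomorphic_unital : unital m <-> unital n.
Proof.
case: iso_mn => h [g hK gK] hM; split=> -[u [ul ur]].
- exists (h u); split=> y; rewrite -(gK y) -hM; first by rewrite ul.
  by rewrite ur.
- exists (g u); split=> x; apply: (can_inj hK); rewrite hM gK; first exact: ul.
  exact: ur.
Qed.

Lemma isomorphic_commutative : commutative m <-> commutative n.
Proof.
case: iso_mn => h [g hK gK] hM; split=> mC x y.
- by rewrite -(gK x) -(gK y) -!hM mC.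
- by apply: (can_inj hK); rewrite !hM mC.
Qed.

Lemma isomorphic_associative : associative m <-> associative n.
Proof.
case: iso_mn => h [g hK gK] hM; split=> mA x y z.
- by rewrite -(gK x) -(gK y) -(gK z) -!hM mA.
- by apply: (can_inj hK); rewrite !hM mA.
Qed.

End Invariance.

(** * The three properties in terms of the parameters *)

Section StructureConstants.
Variables (p q a b c d : 'F_2).
Local Notation S := (algS p q a b c d).

(** With u = xe + yf, the equation ue = e says yc = 1 and x + yd = 0, which
    already forces u = de + f; the conditions on p, q, a, b then come from
    uf = f and eu = e. *)
Lemma algS_unital :
  unital S <-> [/\ p = d, q = 1 - d, a = 1, b = d & c = 1].
Proof.
split.
  case=> u [ul ur].
  have := congr1 (fun v : 'rV_2 => v 0 0) (ul base_e).
  have := congr1 (fun v : 'rV_2 => v 0 1) (ul base_e).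
  have := congr1 (fun v : 'rV_2 => v 0 0) (ul base_f).
  have := congr1 (fun v : 'rV_2 => v 0 1) (ul base_f).
  have := congr1 (fun v : 'rV_2 => v 0 0) (ur base_e).
  have := congr1 (fun v : 'rV_2 => v 0 1) (ur base_e).
  rewrite !(algS_coord_e, algS_coord_f) !mxE /=.
  rewrite !(mulr1, mulr0, mul1r, mul0r, addr0, add0r).
  case: (F2_0or1 (u 0 1)) => ->; first by rewrite !mul0r.
  rewrite !mul1r => + a1 + + + c1; rewrite a1 mulr1.
  move=> /F2_addr_eq0 <- qE /F2_addr_eq0 -> /F2_addr_eq0 <-.
  by split=> //; apply: (addIr (u 0 0)); rewrite subrK -[RHS]qE F2_mulrr.
move=> [-> -> -> -> ->]; exists (d *: base_e + base_f).
split=> x; apply: row2P; rewrite !(algS_coord_e, algS_coord_f) !mxE /=;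
  case: (F2_0or1 d) => ->; case: (F2_0or1 (x 0 0)) => ->;
  case: (F2_0or1 (x 0 1)) => ->; exact/eqP.
Qed.

Lemma algS_commutative : commutative S <-> c = a /\ d = b.
Proof.
split=> [mC | [-> ->] x y].
  have [_ _ ef fe] := algS_table p q a b c d.
  have := mC base_f base_e; rewrite ef fe => eq_fe_ef.
  have := congr1 (fun v : 'rV_2 => v 0 0) eq_fe_ef.
  have := congr1 (fun v : 'rV_2 => v 0 1) eq_fe_ef.
  by rewrite !mxE /= !(mulr1, mulr0, addr0, add0r).
by apply: row2P; rewrite ?algS_coord_e ?algS_coord_f; ring.
Qed.

(** The associativity of the triples (e,e,e) and (e,e,f) already gives the
    equations: they say fe = ef and f^2 = e(ef) = af + b(ef). *)
Lemma algS_associative :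
  associative S <-> [/\ c = a, d = b, p = a * b & q = a + b ^+ 2].
Proof.
split=> [mA | [-> -> -> ->] x y z]; last first.
  by apply: row2P; rewrite !(algS_coord_e, algS_coord_f); ring.
have [ee _ _ _] := algS_table p q a b c d.
have coords (x y : 'rV['F_2]_2) : x = y -> x 0 0 = y 0 0 /\ x 0 1 = y 0 1.
  by move->.
have := coords _ _ (mA base_e base_e base_e).
have := coords _ _ (mA base_e base_e base_f).
rewrite !ee !(algS_coord_e, algS_coord_f) !mxE /=.
rewrite !(mulr1, mulr0, mul1r, mul0r, addr0, add0r).
by case=> <- <- [<- <-]; rewrite mulrC expr2; split.
Qed.

End StructureConstants.

(** * Classification *)

(** The search for the disjunct proved by H compares syntactically, because
    refuting by conversion the equality of two different algebras unfolds their
    bilinear structures, which is expensive. *)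
Ltac pick_disjunct H :=
  let P := type of H in
  match goal with
  | |- ?Q => constr_eq P Q; exact H
  | |- ?Q \/ _ => constr_eq P Q; left; exact H
  | |- _ \/ _ => right; pick_disjunct H
  end.

Theorem proposition7 (A : vectType 'F_2) (m : {bilinear A -> A -> A})
    (dimA : \dim {:A} = 2%N) (straight_m : straight m) :
  [/\ unital m <-> (isomorphic m S7 \/ isomorphic m S11),
      commutative m <->
        (isomorphic m S5 \/ isomorphic m S6 \/ isomorphic m S7 \/
         isomorphic m S8 \/ isomorphic m S9 \/ isomorphic m S10 \/
         isomorphic m S11 \/
         isomorphic m S'1 \/ isomorphic m S'2 \/ isomorphic m S'3 \/
         isomorphic m S'4 \/ isomorphic m S'5 \/ isomorphic m S'6 \/
         isomorphic m S'7 \/ isomorphic m S'8 \/ isomorphic m S'9)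
    & associative m <->
        (isomorphic m S7 \/ isomorphic m S8 \/ isomorphic m S10 \/
         isomorphic m S'10)].
Proof.
have [p [q [a [b [c [d isoS]]]]]] := straight_isomorphic dimA straight_m.
split.
- split=> [/(isomorphic_unital isoS)/algS_unital | ].
    case=> eq_p eq_q eq_a eq_b eq_c; move: isoS.
    rewrite {}eq_p {}eq_q {}eq_a {}eq_b {}eq_c.
    by case: (F2_0or1 d) => ->; rewrite ?subr0 ?subrr; [right | left].
  by case=> isoT; apply/(isomorphic_unital isoT)/algS_unital; split; exact/eqP.
- split=> [/(isomorphic_commutative isoS)/algS_commutative | ].
    case=> eq_c eq_d; move: isoS; rewrite {}eq_c {}eq_d.
    rewrite /S5 /S6 /S7 /S8 /S9 /S10 /S11.
    rewrite /S'1 /S'2 /S'3 /S'4 /S'5 /S'6 /S'7 /S'8 /S'9.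
    case: (F2_0or1 p) => ->; case: (F2_0or1 q) => ->;
    case: (F2_0or1 a) => ->; case: (F2_0or1 b) => -> isoT; pick_disjunct isoT.
  by do 15!
    [case=> [isoT |]; first by apply/(isomorphic_commutative isoT)/algS_commutative];
    move=> isoT; apply/(isomorphic_commutative isoT)/algS_commutative.
- split=> [/(isomorphic_associative isoS)/algS_associative | ].
    case=> eq_c eq_d eq_p eq_q; move: isoS.
    rewrite {}eq_c {}eq_d {}eq_p {}eq_q expr2 F2_mulrr.
    case: (F2_0or1 a) => ->; case: (F2_0or1 b) => ->;
      rewrite ?mulr0 ?mulr1 ?addr0 ?add0r ?F2_addrr => isoT.
    + by right; left.
    + by right; right; left.
    + by right; right; right.
    + by left.
  by case=> [|[|[|]]] isoT;
    apply/(isomorphic_associative isoT)/algS_associative; split; exact/eqP.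
Qed.
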